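(* Let $A_n$ denote the number of entries $\alpha$ or $\gamma$ on the diagonal of a random staircase tableau of size $n$ (chosen uniformly from $\mathcal S_n$), and $B_n$ the number of entries $\beta$ or $\delta$ on the diagonal. The expected value and the variance of $A_n$ are, respectively, \[\mathsf{E}_nA_n=\frac n2\quad\mbox{and}\quad\operatorname{var}(A_n)=\frac{n+1}{12}.\] Moreover, \[\frac{A_n-n/2}{\sqrt{n/12}}\stackrel d\longrightarrow N(0,1).\] Furthermore, for every $n\ge1$ we have \[B_n\stackrel d= A_n.\] In particular, $\mathsf{E}_nB_n=\frac n2$, $\operatorname{var}(B_n)=\frac{n+1}{12}$, and $\frac{B_n-n/2}{\sqrt{n/12}}\stackrel d\longrightarrow N(0,1)$.
   Context: A staircase tableau of size $n$ is a Young diagram of shape $(n,n-1,\dots,2,1)$ whose boxes are filled so that: each box is either empty or contains one of the letters $\alpha,\beta,\delta,\gamma$; no box on the diagonal is empty; all boxes in the same row and to the left of a $\beta$ or a $\delta$ are empty; all boxes in the same column and above an $\alpha$ or a $\gamma$ are empty. Let $\mathcal S_n$ be the set of staircase tableaux of size $n$ (it has $4^nn!$ elements), equipped with the uniform probability measure $\mathsf{P}_n$, with expectation $\mathsf{E}_n$. $\stackrel d=$ denotes equality in distribution and $\stackrel d\longrightarrow$ convergence in distribution; $N(0,1)$ is the standard normal distribution.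
   Formalization: The variance formulas var(A_n) = var(B_n) = (n+1)/12 are stated for n ≥ 2 only, since for n = 1 the variance is 1/4 rather than 1/6. *)

(* Defs.v *)
From HB Require Import structures.
From mathcomp Require Import all_boot all_order all_algebra.
From mathcomp Require Import all_classical all_reals all_analysis.

Set Implicit Arguments.
Unset Strict Implicit.
Unset Printing Implicit Defensive.

Import Order.TTheory GRing.Theory Num.Theory.
Import numFieldNormedType.Exports.

Local Open Scope ring_scope.

Variant letter := Alpha | Beta | Delta | Gamma.

Definition letter_to_bools (l : letter) : bool * bool :=
  match l with
  | Alpha => (true, true) | Beta => (false, true)
  | Delta => (false, false) | Gamma => (true, false)
  end.

Definition letter_of_bools (p : bool * bool) : letter :=
  match p with
  | (true, true) => Alpha | (false, true) => Beta
  | (false, false) => Delta | (true, false) => Gamma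
  end.

Lemma letter_to_boolsK : cancel letter_to_bools letter_of_bools.
Proof. by case. Qed.

HB.instance Definition _ := Finite.copy letter (can_type letter_to_boolsK).

(* Boxes of the Young diagram (n, n-1, ..., 1), as pairs (row, column); rows are
   numbered from the top and columns from the left, both from 0, so that row i
   consists of the boxes (i, j) with j < n - i. *)
Definition box (n : nat) := {p : 'I_n * 'I_n | (p.1 + p.2 < n)%N}.

Definition row_of n (b : box n) : nat := (val b).1.
Definition col_of n (b : box n) : nat := (val b).2.

(* The last boxes of the rows. *)
Definition on_diagonal n (b : box n) : bool := (row_of b + col_of b).+1 == n.

Definition filling (n : nat) := {ffun box n -> option letter}.

HB.instance Definition _ n := Finite.on (filling n).

Definition is_alpha_gamma (x : option letter) : bool :=
  (x == Some Alpha) || (x == Some Gamma).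
Definition is_beta_delta (x : option letter) : bool :=
  (x == Some Beta) || (x == Some Delta).

Definition is_staircase n (f : filling n) : bool :=
  [&& [forall b, on_diagonal b ==> (f b != None)],
      [forall b, forall c,
        [&& is_beta_delta (f b), row_of c == row_of b & (col_of c < col_of b)%N]
          ==> (f c == None)]
    & [forall b, forall c,
        [&& is_alpha_gamma (f b), col_of c == col_of b & (row_of c < row_of b)%N]
          ==> (f c == None)]].

Definition tableau (n : nat) := {f : filling n | is_staircase f}.

HB.instance Definition _ n := Finite.on (tableau n).

Definition diagonal_alpha n : filling n :=
  [ffun b => if on_diagonal b then Some Alpha else None].

Lemma diagonal_alpha_staircase n : is_staircase (diagonal_alpha n).
Proof.
apply/and3P; split.
- by apply/forallP => b; apply/implyP => db; rewrite ffunE db.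
- apply/forallP => b; apply/forallP => c; apply/implyP.
  by rewrite !ffunE; case: ifP.
- apply/forallP => b; apply/forallP => c; apply/implyP.
  rewrite !ffunE; case: ifP => // /eqP db /and3P[_ /eqP cb rb].
  rewrite ifF//; apply/negbTE/eqP => dc; move: rb.
  have : (row_of b + col_of b = row_of c + col_of b)%N.
    by apply: succn_inj; rewrite db -cb dc.
  by move/addIn => ->; rewrite ltnn.
Qed.

HB.instance Definition _ n := isPointed.Build (tableau n)
  (exist _ (diagonal_alpha n) (diagonal_alpha_staircase n)).

HB.instance Definition _ n := @isMeasurable.Build default_measure_display
  (tableau n) discrete_measurable discrete_measurable0
  discrete_measurableC discrete_measurableU.

Section uniform.
Context {R : realType} (n : nat).
Local Open Scope ereal_scope.

Definition tableau_prob (E : set (tableau n)) : \bar R :=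
  (#|[pred t | t \in E]|%:R / #|{: tableau n}|%:R)%:E.

Lemma card_tableau_gt0 : (0 < #|{: tableau n}|)%N.
Proof. by apply/card_gt0P; exists point. Qed.

Lemma tableau_probE (E : set (tableau n)) :
  tableau_prob E = mscale ((#|{: tableau n}|%:R : R)^-1%:nng)%R
    (msum (fun i => \d_(nth point (enum {: tableau n}) i)) #|{: tableau n}|) E.
Proof.
rewrite /mscale /= /msum /tableau_prob mulrC EFinM; congr (_ * _).
transitivity (\sum_(t : tableau n) (\d_t E : \bar R)); last first.
  by rewrite -big_enum/= (big_nth point) big_mkord cardE.
rewrite -sum1_card natr_sum -sumEFin big_mkcond/=.
by apply: eq_bigr => t _; rewrite diracE inE; case: (t \in E).
Qed.

Let tableau_prob0 : tableau_prob set0 = 0.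
Proof. by rewrite tableau_probE measure0. Qed.

Let tableau_prob_ge0 E : 0 <= tableau_prob E.
Proof. by rewrite tableau_probE measure_ge0. Qed.

Let tableau_prob_sigma_additive : semi_sigma_additive tableau_prob.
Proof.
by rewrite (funext tableau_probE); exact: measure_semi_sigma_additive.
Qed.

HB.instance Definition _ := isMeasure.Build _ _ _ tableau_prob
  tableau_prob0 tableau_prob_ge0 tableau_prob_sigma_additive.

Let tableau_prob_setT : tableau_prob [set: _] = 1.
Proof.
rewrite /tableau_prob (@eq_card _ _ {: tableau n}); last first.
  by move=> t; rewrite !inE in_setT.
by rewrite divff// pnatr_eq0 -lt0n card_tableau_gt0.
Qed.

HB.instance Definition _ :=
  @Measure_isProbability.Build _ _ R tableau_prob tableau_prob_setT.

End uniform.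
Arguments tableau_prob R n : clear implicits.

Lemma measurable_tableau (R : realType) n (f : tableau n -> R) :
  measurable_fun [set: tableau n] f.
Proof. by []. Qed.

Definition diag_alpha_gamma (R : realType) n (t : tableau n) : R :=
  #|[pred b : box n | on_diagonal b && is_alpha_gamma (val t b)]|%:R.

Definition diag_beta_delta (R : realType) n (t : tableau n) : R :=
  #|[pred b : box n | on_diagonal b && is_beta_delta (val t b)]|%:R.

HB.instance Definition _ (R : realType) n :=
  isMeasurableFun.Build _ _ _ _ (@diag_alpha_gamma R n)
    (measurable_tableau (@diag_alpha_gamma R n)).

HB.instance Definition _ (R : realType) n :=
  isMeasurableFun.Build _ _ _ _ (@diag_beta_delta R n)
    (measurable_tableau (@diag_beta_delta R n)).

(* The norming sqrt (n / 12) is only asymptotic to the standard deviation. *)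
Definition standardized (R : realType) n (X : tableau n -> R) (t : tableau n) : R :=
  (X t - n%:R / 2) / Num.sqrt (n%:R / 12).

HB.instance Definition _ (R : realType) n (X : tableau n -> R) :=
  isMeasurableFun.Build _ _ _ _ (standardized X)
    (measurable_tableau (standardized X)).

Local Open Scope classical_set_scope.

Definition eq_distribution (R : realType)
    (d1 : measure_display) (T1 : measurableType d1) (P1 : probability T1 R)
    (d2 : measure_display) (T2 : measurableType d2) (P2 : probability T2 R)
    (X : {RV P1 >-> R}) (Y : {RV P2 >-> R}) : Prop :=
  forall E : set R, measurable E -> distribution P1 X E = distribution P2 Y E.

(* Pointwise convergence of the cdf at the continuity points of the limit cdf. *)
Definition cvg_distribution (R : realType) (d : measure_display)
    (T : nat -> measurableType d) (P : forall n, probability (T n) R)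
    (X : forall n, {RV (P n) >-> R}) (mu : probability (measurableTypeR R) R) : Prop :=
  forall x : R, {for x, continuous (fun r : R => mu `]-oo, r])} ->
    cdf (X n) x @[n --> \oo] --> mu `]-oo, x].

(* Main.v *)
Require Import Defs.
From HB Require Import structures.
From mathcomp Require Import all_boot all_order all_algebra.
From mathcomp Require Import all_classical all_reals all_analysis.
From mathcomp Require Import ring lra zify.

(* Deleting the first column of a tableau of size [n + 1] leaves a tableau of size [n].
   Counting the columns that can be put back, by the number [r] of rows without beta or
   delta, gives for [F_n(x, z) = sum_t x^(A t) z^(r t)] the recursion
     [F_(n+1)(x, z) = 2 z (x - 1) F_n(x, z) + 2 (1 + z) F_n(x, z + 2)],
   which forces the Eulerian-type recursion
     [F_(n+1) = 2 (1 + (2 n + z) x) F_n + 4 x (1 - x) dF_n/dx].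
   At [z = 1] it says that [A_n] is a Markov chain: from [A_n = k] it stays at [k] with
   probability [(2 k + 1) / (2 n + 2)] and moves to [k + 1] otherwise.  Mean, variance and
   the symmetry [k <-> n - k], hence [B_n = n - A_n] distributed as [A_n], are read off.
   For the limit law, [n (A_n - n / 2)] is a martingale, and [Phi (w / sqrt T)] solves the
   heat equation; evaluating it along the rescaled martingale with [T] the variance still
   to come (plus a fixed [e > 0]) changes its expectation by O(n^(-3/2)) at each step.
   Thus the smoothed distribution function [E Phi ((a - X_n) / sqrt e)] tends to
   [Phi (a / sqrt (1 + e))], and [e] is then sent to [0]. *)

Set Implicit Arguments.
Unset Strict Implicit.
Unset Printing Implicit Defensive.

Import Order.TTheory GRing.Theory Num.Theory.
Import numFieldNormedType.Exports.
Local Open Scope ring_scope.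

(** * Removing the first column of a tableau *)

Definition row_free n (f : filling n) (i : nat) : bool :=
  [forall b, (row_of b == i) ==> ~~ is_beta_delta (f b)].

(* Rows are listed from the bottom to the top. *)
Definition free_rows n (f : filling n) : seq bool :=
  [seq row_free f (n - i) | i <- iota 1 n].

Definition diag_count n (f : filling n) : nat :=
  #|[pred b : box n | on_diagonal b && is_alpha_gamma (f b)]|.

(** A column is read from the bottom up, so the boxes above an alpha or gamma are the later entries
    of [c]. The flags [s] mark the rows in which a letter may still be put on the left. That the
    diagonal box is filled is required separately, which leaves this predicate fit for induction on
    [s]. *)
Definition column_ok (s : seq bool) (c : seq (option letter)) : bool :=
  all2 (fun b x => b || (x == None)) s c
  && pairwise (fun x y => is_alpha_gamma x ==> (y == None)) c.

Definition next_free (s : seq bool) (c : seq (option letter)) : seq bool :=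
  [seq p.1 && ~~ is_beta_delta p.2 | p <- zip s c].

(** Row [n] lies just below the diagram of size [n]. It is the row opened by the diagonal box of a
    new first column, whence the [true] put in front of [free_rows]. *)
Lemma row_free_last n (f : filling n) : row_free f n.
Proof.
apply/forallP => b; apply/implyP => /eqP bn.
by have := valP b; rewrite /row_of in bn; rewrite bn /=; lia.
Qed.

Lemma size_free_rows n (f : filling n) : size (free_rows f) = n.
Proof. by rewrite size_map size_iota. Qed.

Lemma nth_free_rows n (f : filling n) i : (i <= n)%N ->
  nth false (true :: free_rows f) i = row_free f (n - i).
Proof.
case: i => [|i] i_n /=; first by rewrite subn0 row_free_last.
by rewrite (nth_map 0%N) ?size_iota// nth_iota// add1n.
Qed.

Section boxes.
Variable n : nat.

Definition mk_box m (i j : 'I_m) (ij : (i + j < m)%N) : box m :=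
  exist (fun p : 'I_m * 'I_m => (p.1 + p.2 < m)%N) (i, j) ij.

Fact shift_box_subproof (b : box n) :
  (widen_ord (leqnSn n) (val b).1 + lift ord0 (val b).2 < n.+1)%N.
Proof. by rewrite /= /bump /= add1n addnS ltnS; exact: (valP b). Qed.

Definition shift_box (b : box n) : box n.+1 := mk_box (shift_box_subproof b).

Fact column_box_subproof (i : 'I_n.+1) : (rev_ord i + (ord0 : 'I_n.+1) < n.+1)%N.
Proof. by rewrite /= addn0 subSS ltnS leq_subr. Qed.

(** The first column is indexed from the bottom, in the order of [free_rows]: index 0 is its
    diagonal box. *)
Definition column_box (i : 'I_n.+1) : box n.+1 := mk_box (column_box_subproof i).

Lemma row_shift_box b : row_of (shift_box b) = row_of b.
Proof. by []. Qed.

Lemma col_shift_box b : col_of (shift_box b) = (col_of b).+1.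
Proof. by rewrite /col_of /= /bump /= add1n. Qed.

Lemma row_column_box i : row_of (column_box i) = (n - i)%N.
Proof. by rewrite /row_of /= subSS. Qed.

Lemma col_column_box i : col_of (column_box i) = 0%N.
Proof. by []. Qed.

Lemma on_diagonal_shift_box b : on_diagonal (shift_box b) = on_diagonal b.
Proof. by rewrite /on_diagonal row_shift_box col_shift_box addnS eqSS. Qed.

Lemma on_diagonal_column_box i : on_diagonal (column_box i) = (i == ord0).
Proof.
rewrite /on_diagonal row_column_box col_column_box addn0 eqSS -val_eqE /=.
by have := ltn_ord i; lia.
Qed.

Lemma shift_box_inj : injective shift_box.
Proof.
move=> [[i j] ij] [[i' j'] ij'] eb; apply/val_inj.
have := congr1 (@row_of n.+1) eb; have := congr1 (@col_of n.+1) eb.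
rewrite !row_shift_box !col_shift_box /row_of /col_of /= => -[e2] e1.
by rewrite (ord_inj e1) (ord_inj e2).
Qed.

Lemma column_box_inj : injective column_box.
Proof.
move=> i j /(congr1 (@row_of n.+1)); rewrite !row_column_box => e.
by apply/val_inj => /=; have := ltn_ord i; have := ltn_ord j; lia.
Qed.

Lemma column_shift_box i b : (column_box i == shift_box b) = false.
Proof.
apply/eqP => /(congr1 (@col_of n.+1)).
by rewrite col_shift_box col_column_box.
Qed.

Variant box_spec : box n.+1 -> Prop :=
| ShiftBox b : box_spec (shift_box b)
| ColumnBox i : box_spec (column_box i).

Lemma boxP b : box_spec b.
Proof.
case: b => -[i j] /= ij; case: (unliftP ord0 j) => [j'|] ej.
  have ij' : (i + j' < n)%N by move: ij; rewrite ej /= /bump /=; lia.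
  have i_n : (i < n)%N by lia.
  have -> : exist _ (i, j) ij
            = shift_box (@mk_box n (Ordinal i_n) j' ij').
    by apply/val_inj => /=; rewrite ej; congr pair; exact: ord_inj.
  exact: ShiftBox.
have -> : exist _ (i, j) ij = column_box (rev_ord i).
  by apply/val_inj => /=; rewrite ej rev_ordK.
exact: ColumnBox.
Qed.

(** The index [n - row_of b] is below [n + 1], so [inord] never returns its default value. *)
Definition glue (p : filling n * n.+1.-tuple (option letter)) : filling n.+1 :=
  [ffun b => if [pick b' | shift_box b' == b] is Some b' then p.1 b'
             else tnth p.2 (inord (n - row_of b))].

Definition unglue (g : filling n.+1) : filling n * n.+1.-tuple (option letter) :=
  ([ffun b => g (shift_box b)], [tuple g (column_box i) | i < n.+1]).

Lemma glue_shift p b : glue p (shift_box b) = p.1 b.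
Proof.
rewrite ffunE; case: pickP => [b' /eqP/shift_box_inj -> //|/(_ b)].
by rewrite eqxx.
Qed.

Lemma glue_column p i : glue p (column_box i) = tnth p.2 i.
Proof.
rewrite ffunE; case: pickP => [b'|_]; first by rewrite eq_sym column_shift_box.
rewrite row_column_box; congr tnth; apply/val_inj; rewrite /= inordK;
  by have := ltn_ord i; lia.
Qed.

Lemma glueK : cancel glue unglue.
Proof.
move=> [f c]; rewrite /unglue; congr pair.
  by apply/ffunP => b; rewrite ffunE glue_shift.
by apply/eq_from_tnth => i; rewrite tnth_mktuple glue_column.
Qed.

Lemma unglueK : cancel unglue glue.
Proof.
move=> g; apply/ffunP => b; case: (boxP b) => [b'|i].
  by rewrite glue_shift ffunE.
by rewrite glue_column tnth_mktuple.
Qed.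

Lemma glue_bij : bijective glue.
Proof. exact: Bijective glueK unglueK. Qed.

Lemma row_free_glue p (i : 'I_n.+1) :
  row_free (glue p) (n - i) = row_free p.1 (n - i) && ~~ is_beta_delta (tnth p.2 i).
Proof.
apply/forallP/andP => [h|[/forallP h1 h2]].
  split; last first.
    by have /implyP := h (column_box i); rewrite row_column_box glue_column; exact.
  apply/forallP => b; have := h (shift_box b).
  by rewrite row_shift_box glue_shift.
move=> b; case: (boxP b) => [b'|j].
  by rewrite row_shift_box glue_shift; exact: h1.
rewrite row_column_box glue_column; apply/implyP => /eqP ij.
suff -> : j = i by [].
by apply/val_inj => /=; have := ltn_ord i; have := ltn_ord j; lia.
Qed.

Lemma free_rows_glue p :
  free_rows (glue p) = next_free (true :: free_rows p.1) p.2.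
Proof.
have sz : size (zip (true :: free_rows p.1) p.2) = n.+1.
  by rewrite size_zip /= size_free_rows size_tuple minnn.
apply: (@eq_from_nth _ false) => [|i].
  by rewrite size_free_rows /next_free size_map sz.
rewrite size_free_rows => i_n; rewrite (nth_map 0%N) ?size_iota//.
rewrite nth_iota// add1n subSS (nth_map (false, None)) ?sz//.
rewrite nth_zip /=; last by rewrite size_free_rows size_tuple.
rewrite (row_free_glue p (Ordinal i_n)) (tnth_nth None) /=.
by rewrite -nth_free_rows.
Qed.

(** Only the bottom box of the new column is on the diagonal; the other diagonal boxes are the
    shifts of the old ones. *)
Lemma diag_count_glue p :
  diag_count (glue p) = (is_alpha_gamma (thead p.2) + diag_count p.1)%N.
Proof.
rewrite /diag_count -!sum1_card.
rewrite (bigID [pred b | b == column_box ord0]) /=; congr addn.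
  rewrite big_mkcond (bigD1 (column_box ord0)) //= big1 ?addn0; last first.
    by move=> b /negbTE ->; rewrite andbF.
  by rewrite eqxx andbT inE on_diagonal_column_box eqxx glue_column /thead /=; case: is_alpha_gamma.
rewrite -(big_imset (h := shift_box) (fun=> 1%N)) /=; last first.
  by move=> b b' _ _; exact: shift_box_inj.
apply: eq_bigl => b; case: (boxP b) => [b'|i].
  rewrite (mem_imset _ _ shift_box_inj) !inE on_diagonal_shift_box glue_shift.
  by rewrite eq_sym column_shift_box andbT.
rewrite !inE on_diagonal_column_box (inj_eq column_box_inj).
rewrite andbAC andbN /=; apply/esym/negbTE/imsetP => -[b' _ /eqP].
by rewrite column_shift_box.
Qed.

(** Conditions between old boxes are those of [p.1]. Nothing lies to the left of the first column,
    so across the two pieces only the betas and deltas of old rows act: they force the new boxes of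
    their rows to be empty. The column condition on the new boxes is the pairwise clause of
    [column_ok]. *)
Lemma staircase_glue p :
  is_staircase (glue p) =
  is_staircase p.1 && ((thead p.2 != None) && column_ok (true :: free_rows p.1) p.2).
Proof.
have all2E : all2 (fun b x => b || (x == None)) (true :: free_rows p.1) p.2 =
    [forall i : 'I_n.+1, row_free p.1 (n - i) || (tnth p.2 i == None)].
  rewrite all2E /= size_free_rows size_tuple eqxx /=.
  apply/(all_nthP (false, None))/forallP => h.
    move=> i; have := h i; rewrite size_zip /= size_free_rows size_tuple minnn.
    move=> /(_ (ltn_ord i)); rewrite nth_zip /=; last by rewrite size_free_rows size_tuple.
    by rewrite nth_free_rows ?(tnth_nth None) // -ltnS.
  move=> i; rewrite size_zip /= size_free_rows size_tuple minnn => i_n.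
  rewrite nth_zip /=; last by rewrite size_free_rows size_tuple.
  by have := h (Ordinal i_n); rewrite nth_free_rows ?(tnth_nth None).
have pwP : reflect (forall i j : 'I_n.+1, (i < j)%N -> is_alpha_gamma (tnth p.2 i) ->
      tnth p.2 j = None)
    (pairwise (fun x y => is_alpha_gamma x ==> (y == None)) p.2).
  apply: (iffP (pairwiseP None)) => h.
    move=> i j ij ai; apply/eqP; move: ai; apply/implyP.
    by rewrite !(tnth_nth None); apply: h; rewrite ?inE ?size_tuple.
  move=> i j; rewrite !inE size_tuple => i_n j_n ij.
  have := h (Ordinal i_n) (Ordinal j_n) ij; rewrite !(tnth_nth None) /=.
  by move=> h'; apply/implyP => /h' ->.
apply/and3P/andP => [[/forallP h1 /forallP h2 /forallP h3]|].
  split; first (apply/and3P; split).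
  - apply/forallP => b; have := h1 (shift_box b).
    by rewrite on_diagonal_shift_box glue_shift.
  - apply/forallP => b; apply/forallP => b'.
    have /forallP/(_ (shift_box b')) := h2 (shift_box b).
    by rewrite !row_shift_box !col_shift_box !glue_shift ltnS.
  - apply/forallP => b; apply/forallP => b'.
    have /forallP/(_ (shift_box b')) := h3 (shift_box b).
    by rewrite !row_shift_box !col_shift_box !glue_shift eqSS.
  apply/andP; split.
    by have := h1 (column_box ord0); rewrite on_diagonal_column_box glue_column.
  rewrite /column_ok all2E; apply/andP; split.
    apply/forallP => i; rewrite -implyNb; apply/implyP => /forallPn[b].
    rewrite negb_imply negbK => /andP[/eqP rb fb].
    have /forallP/(_ (column_box i)) := h2 (shift_box b).
    rewrite row_column_box row_shift_box rb glue_shift glue_column fb eqxx.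
    by rewrite col_shift_box col_column_box.
  apply/pwP => i j ij ai; have /forallP/(_ (column_box j)) := h3 (column_box i).
  rewrite !row_column_box !col_column_box !glue_column ai eqxx /= ltn_sub2l //.
    by move/eqP.
  by have := ltn_ord j; lia.
move=> [/and3P[/forallP h1 /forallP h2 /forallP h3]] /andP[h4 /andP[]].
rewrite all2E => /forallP h5 /pwP h6; split.
- apply/forallP => b; case: (boxP b) => [b'|i].
    by rewrite on_diagonal_shift_box glue_shift.
  by rewrite on_diagonal_column_box glue_column; apply/implyP => /eqP ->.
- apply/forallP => b; apply/forallP => b'; case: (boxP b) => [{}b|i]; last first.
    by apply/implyP => /and3P[_ _]; rewrite col_column_box.
  case: (boxP b') => [{}b'|i].
    have /forallP/(_ b') := h2 b.
    by rewrite !row_shift_box !col_shift_box !glue_shift ltnS.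
  rewrite row_column_box row_shift_box glue_shift glue_column; apply/implyP.
  move=> /and3P[fb /eqP ib _]; have := h5 i.
  case/orP => // /forallP/(_ b); by rewrite ib eqxx fb.
- apply/forallP => b; apply/forallP => b'.
  case: (boxP b) => [{}b|i]; case: (boxP b') => [{}b'|j].
  + have /forallP/(_ b') := h3 b.
    by rewrite !row_shift_box !col_shift_box !glue_shift eqSS.
  + by rewrite col_column_box col_shift_box andbF.
  + by rewrite col_column_box col_shift_box andbF.
  + rewrite !row_column_box !glue_column; apply/implyP => /and3P[ai _ ij].
    by apply/eqP/(h6 _ _ _ ai); lia.
Qed.

End boxes.

(** * The recursion for the joint generating function *)

Section generating_function.
Variable R : comNzRingType.
Implicit Types (f : nat -> R) (z : R).

Lemma sum_option_letter (F : option letter -> R) :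
  \sum_x F x = F None + F (Some Alpha) + F (Some Gamma) + F (Some Beta) + F (Some Delta).
Proof.
rewrite (bigD1 None) // (bigD1 (Some Alpha)) // (bigD1 (Some Gamma)) //.
rewrite (bigD1 (Some Beta)) // (bigD1 (Some Delta)) //= big1 ?addr0 ?addrA //.
by case=> [[]|].
Qed.

Lemma sum_tuple_cons (T : finType) m (P : pred (m.+1.-tuple T)) (F : m.+1.-tuple T -> R) :
  \sum_(c | P c) F c =
  \sum_x \sum_(c : m.-tuple T | P [tuple of x :: c]) F [tuple of x :: c].
Proof.
rewrite pair_big_dep /=.
rewrite (reindex (fun p : T * m.-tuple T => [tuple of p.1 :: p.2])) //=.
exists (fun c : m.+1.-tuple T => (thead c, [tuple of behead c])).
  by move=> [x c] _ /=; congr pair; apply/val_inj.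
by move=> c _; rewrite -tuple_eta.
Qed.

Lemma sum_column_empty (s : seq bool) z :
  \sum_(c : (size s).-tuple (option letter)
         | column_ok s c && all (pred1 None) c) z ^+ count id (next_free s c)
  = z ^+ count id s.
Proof.
have Pn : forall c : (size s).-tuple (option letter),
    (column_ok s c && all (pred1 None) c) = (c == nseq_tuple (size s) None).
  move=> c; apply/andP/eqP => [[_]|->].
    by move/all_pred1P; rewrite size_tuple => e; apply/val_inj.
  split; last exact: all_pred1_nseq.
  rewrite /column_ok; apply/andP; split.
    by elim: s {c} => //= b s ->; rewrite orbT.
  by elim: (size s) => //= m ->; rewrite andbT; apply/allP.
rewrite (eq_bigl _ _ Pn) big_pred1_eq; congr (_ ^+ _).
by elim: s {Pn} => //= b s <-; rewrite /= andbT.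
Qed.

(** From the bottom up, a free row that is left empty contributes [z], and a beta or delta
    contributes 1 each. An alpha or gamma forces all boxes above to be empty, giving [z ^ (r + 1)]
    each when [r] free rows remain above. Hence [S (r + 1) = (z + 2) S r + 2 z ^ (r + 1)], solved by
    the closed form; a row that is not free must be empty and changes nothing. *)
Lemma sum_column (s : seq bool) z :
  \sum_(c : (size s).-tuple (option letter) | column_ok s c)
     z ^+ count id (next_free s c)
  = (z + 2) ^+ count id s * (1 + z) - z ^+ (count id s).+1.
Proof.
elim: s => [|b s IHs].
  rewrite (bigD1 [tuple]) //= big1 ?addr0; last first.
    by move=> c; rewrite tuple0.
  rewrite /next_free /=; ring.
have okN : forall b x (c : (size s).-tuple (option letter)), ~~ is_alpha_gamma x ->
    column_ok (b :: s) (x :: c) = (b || (x == None)) && column_ok s c.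
  move=> {}b x c /negbTE xa; rewrite /column_ok /= xa /= all_predT.
  by rewrite -andbA.
(* An alpha or gamma is allowed only in a free row, and then the rest of the column is the empty one
   counted by [sum_column_empty]. *)
have okA : forall b x (c : (size s).-tuple (option letter)), is_alpha_gamma x ->
    column_ok (b :: s) (x :: c) = b && (column_ok s c && all (pred1 None) c).
  move=> {}b x c xa; rewrite /column_ok /= xa /=.
  have -> : (x == None) = false by case: x xa.
  rewrite orbF -!andbA; congr (_ && (_ && _)); rewrite andbC; congr andb.
have nfN b' x (c : (size s).-tuple (option letter)) :
    count id (next_free (b' :: s) (x :: c)) =
    ((b' && ~~ is_beta_delta x) + count id (next_free s c))%N by [].
pose G x := \sum_(c : (size s).-tuple (option letter) | column_ok (b :: s) (x :: c))
     z ^+ count id (next_free (b :: s) (x :: c)).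
transitivity (\sum_x G x); first exact: sum_tuple_cons.
have GN x : ~~ is_alpha_gamma x -> G x =
   if b || (x == None) then z ^+ (b && ~~ is_beta_delta x) *
      ((z + 2) ^+ count id s * (1 + z) - z ^+ (count id s).+1) else 0.
  move=> xN; rewrite /G; case: ifP => bx.
    rewrite -IHs mulr_sumr; apply: eq_big => [c|c _]; first by rewrite okN // bx.
    by rewrite nfN exprD.
  by rewrite big_pred0 // => c; rewrite okN // bx.
have GA x : is_alpha_gamma x -> G x = if b then z * z ^+ count id s else 0.
  move=> xA; rewrite /G; case: ifP => bx.
    rewrite -(sum_column_empty s) mulr_sumr; apply: eq_big => [c|c _].
      by rewrite okA.
    by rewrite nfN exprD /=; case: x xA => // -[].
  by rewrite big_pred0 // => c; rewrite okA.
rewrite sum_option_letter (GN None) // (GA (Some Alpha)) // (GA (Some Gamma)) //.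
rewrite (GN (Some Beta)) // (GN (Some Delta)) //= /is_beta_delta /=; clearbody G.
case: b {okN okA nfN GN GA} => /=; last by rewrite add0n; ring.
rewrite add1n !exprS; ring.
Qed.

(** For [f k = x ^ k] this is the generating function [F_n(x, z)]. With a general weight [f],
    multiplication by [x] becomes the shift of [f], and no polynomials or derivatives in [x] are
    needed. *)
Definition weighted_sum n f z : R :=
  \sum_(t : filling n | is_staircase t) f (diag_count t) * z ^+ count id (free_rows t).

Lemma weighted_sum0 f z : weighted_sum 0 f z = f 0%N.
Proof.
have noB : forall b : box 0, False by case=> -[[]].
rewrite /weighted_sum (bigD1 (@diagonal_alpha 0)) ?diagonal_alpha_staircase //=.
rewrite mulr1 big1 ?addr0 => [|t /andP[_ /eqP []]]; last first.
  by apply/ffunP => b; case: (noB b).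
by congr f; rewrite /diag_count eq_card0 // => b; case: (noB b).
Qed.

(** Split by the diagonal box of the new column. An alpha or gamma there empties the column and
    gives [f (k + 1) z ^ (r + 1)]; a beta or delta leaves a column counted by [sum_column] with
    weight [f k]. The term [- z ^ (r + 1)] of that count produces the difference of [f]. *)
Lemma weighted_sumS n f z :
  weighted_sum n.+1 f z = 2 * z * weighted_sum n (fun k => f k.+1 - f k) z
                          + 2 * (1 + z) * weighted_sum n f (z + 2).
Proof.
rewrite /weighted_sum (reindex _ (onW_bij _ (glue_bij n))) /=.
under eq_bigl do rewrite staircase_glue.
rewrite -(pair_big_dep (@is_staircase n)
  (fun t (c : n.+1.-tuple (option letter)) =>
     (thead c != None) && column_ok (true :: free_rows t) c)
  (fun t c => f (diag_count (glue (t, c))) * z ^+ count id (free_rows (glue (t, c))))) /=.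
rewrite !mulr_sumr -big_split /=; apply: eq_bigr => t _.
set s := free_rows t.
have sz : size s = n by exact: size_free_rows.
pose G x := \sum_(c : n.-tuple (option letter)
    | (thead [tuple of x :: c] != None) && column_ok (true :: s) (x :: c))
  f (diag_count (glue (t, [tuple of x :: c]))) *
  z ^+ count id (free_rows (glue (t, [tuple of x :: c]))).
transitivity (\sum_x G x); first exact: sum_tuple_cons.
have GN : G None = 0 by rewrite /G big_pred0.
have GA x : is_alpha_gamma x -> G x = f (diag_count t).+1 * z ^+ (count id s).+1.
  move=> xA; rewrite exprS -(sum_column_empty s) sz !mulr_sumr.
  have xN : x != None by case: x xA.
  have xB : is_beta_delta x = false by case: x xA {xN} => // -[].
  apply: eq_big => c; first by rewrite theadE xN /column_ok /= xA /= andbA andbAC.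
  by rewrite diag_count_glue free_rows_glue theadE xA /next_free /= xB exprD expr1.
have GB x : is_beta_delta x -> G x =
    f (diag_count t) * ((z + 2) ^+ count id s * (1 + z) - z ^+ (count id s).+1).
  move=> xB; rewrite -(sum_column s) sz !mulr_sumr.
  have xN : x != None by case: x xB.
  have xA : is_alpha_gamma x = false by case: x xB {xN} => // -[].
  apply: eq_big => c; first by rewrite theadE xN /column_ok /= xA /= all_predT.
  by rewrite diag_count_glue free_rows_glue theadE xA /next_free /= xB.
rewrite sum_option_letter GN (GA (Some Alpha)) // (GA (Some Gamma)) //.
rewrite (GB (Some Beta)) // (GB (Some Delta)) //; clearbody G s.
rewrite exprS; ring.
Qed.

(* The operator on the right is multiplication by [1 + (2 n + z) x + 2 x (1 - x) d/dx]
   on generating functions in [x]; it commutes with the recursion of [weighted_sumS]. *)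
Lemma weighted_sum_eulerian n f z :
  weighted_sum n.+1 f z =
  2 * weighted_sum n (fun k => (2 * k%:R + 1) * f k
                               + (2 * n%:R + z - 2 * k%:R) * f k.+1) z.
Proof.
elim: n f z => [|n IHn] f z.
  rewrite weighted_sumS !weighted_sum0; ring.
(* Let [T_(n,z)] be the operator on [f] in the statement and [D] the forward difference. The two
   summands match because [T_(n,z) D = D T_(n+1,z)] and [T_(n,z+2) = T_(n+1,z)]. *)
rewrite weighted_sumS [in RHS]weighted_sumS !IHn [RHS]mulrDr.
congr (_ + _).
  rewrite !mulrA [2 * z * 2]mulrAC -!mulrA; congr (_ * (_ * (_ * _))).
  rewrite /weighted_sum; apply: eq_bigr => t _; congr (_ * _).
  rewrite -!natr1; ring.
rewrite mulrCA; congr (_ * (_ * _)).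
rewrite /weighted_sum; apply: eq_bigr => t _; congr (_ * _).
rewrite -!natr1; ring.
Qed.

End generating_function.

(** * The Eulerian Markov chain *)

Section chain.
Variable R : realType.
Implicit Types g h : nat -> R.

(** The conditional mean of [g] at time [n + 1] given state [k] at time [n]; [chain_mean] composes
    these operators back to the start at 0. *)
Definition chain_step n g (k : nat) : R :=
  ((2 * k%:R + 1) * g k + (2 * n%:R + 1 - 2 * k%:R) * g k.+1) / (2 * n.+1%:R).

Fixpoint chain_mean n g : R :=
  if n is m.+1 then chain_mean m (chain_step m g) else g 0%N.

(** The chain is within [[0, n]] at time [n], and for [k <= n] both weights of [chain_step] are
    positive. *)
Lemma chain_mean_le n g h : (forall k, (k <= n)%N -> g k <= h k) ->
  chain_mean n g <= chain_mean n h.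
Proof.
elim: n g h => [|n IHn] g h gh /=; first exact: gh.
apply: IHn => k kn; rewrite /chain_step ler_pM2r ?invr_gt0 ?mulr_gt0 //.
have kn' : k%:R <= n%:R :> R by rewrite ler_nat.
have k0 : 0 <= k%:R :> R by [].
by apply: lerD; apply: ler_wpM2l; [lra|apply: gh; lia|lra|apply: gh; lia].
Qed.

Lemma eq_chain_mean n g h : (forall k, (k <= n)%N -> g k = h k) ->
  chain_mean n g = chain_mean n h.
Proof.
by move=> gh; apply/eqP; rewrite eq_le !chain_mean_le // => k /gh ->.
Qed.

Lemma chain_meanD n g h :
  chain_mean n (fun k => g k + h k) = chain_mean n g + chain_mean n h.
Proof.
elim: n g h => //= n IHn g h; rewrite -IHn; apply: eq_chain_mean => k _.
by rewrite /chain_step; ring.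
Qed.

Lemma chain_meanZ n c g : chain_mean n (fun k => c * g k) = c * chain_mean n g.
Proof.
elim: n g => //= n IHn g; rewrite -IHn; apply: eq_chain_mean => k _.
by rewrite /chain_step; ring.
Qed.

Lemma chain_mean_cst n c : chain_mean n (fun=> c) = c.
Proof.
elim: n => //= n IHn; rewrite -[RHS]IHn; apply: eq_chain_mean => k _.
rewrite /chain_step; have : n.+1%:R != 0 :> R by rewrite pnatr_eq0.
by rewrite -natr1 => n0; field.
Qed.

(** One step multiplies the conditional mean of the centered variable by [1 - 1 / (n + 1)]. *)
Lemma chain_mean_center n : chain_mean n (fun k => k%:R - n%:R / 2) = 0.
Proof.
elim: n => [|n IHn] /=; first by rewrite mul0r subr0.
rewrite -[RHS](mulr0 (1 - n.+1%:R^-1)) -IHn -chain_meanZ.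
apply: eq_chain_mean => k _.
rewrite /chain_step; have : n.+1%:R != 0 :> R by rewrite pnatr_eq0.
by rewrite -!natr1 => n0; field.
Qed.

Lemma chain_mean_sqrS n :
  chain_mean n.+1 (fun k => (k%:R - n.+1%:R / 2) ^+ 2) =
  (1 - 2 / n.+1%:R) * chain_mean n (fun k => (k%:R - n%:R / 2) ^+ 2) + 4^-1.
Proof.
rewrite -chain_meanZ -[4^-1](chain_mean_cst n) -chain_meanD [LHS]/=.
apply: eq_chain_mean => k _.
rewrite /chain_step; have : n.+1%:R != 0 :> R by rewrite pnatr_eq0.
by rewrite -!natr1 => n0; field.
Qed.

Lemma chain_mean_sqr n : (2 <= n)%N ->
  chain_mean n (fun k => (k%:R - n%:R / 2) ^+ 2) = (n%:R + 1) / 12.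
Proof.
elim: n => // -[|[|n]] IHn _ //; rewrite chain_mean_sqrS.
  (* For size 2 the factor [1 - 2 / 2] vanishes, so the recursion starts afresh from 1/4. At size 1
     the variance is 1/4, not 1/6. *)
  by rewrite divff ?pnatr_eq0 // subrr mul0r add0r; lra.
rewrite IHn //; have : n.+3%:R != 0 :> R by rewrite pnatr_eq0.
by rewrite -[n.+3%:R]natr1 => n0; field.
Qed.

Lemma chain_mean_sqr_le n :
  chain_mean n (fun k => (k%:R - n%:R / 2) ^+ 2) <= n%:R / 4.
Proof.
elim: n => [|n IHn]; first by rewrite /= !mul0r subr0 expr0n.
rewrite chain_mean_sqrS.
have -> : n.+1%:R / 4 = n%:R / 4 + 4^-1 :> R by rewrite -natr1; field.
rewrite lerD2r (le_trans _ IHn) // ler_piMl ?gerBl ?divr_ge0 //.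
by rewrite -(chain_mean_cst n 0) chain_mean_le // => k _; exact: sqr_ge0.
Qed.

(** The reflection [k -> n - k] exchanges the weights [2 k + 1] and [2 n + 1 - 2 k], hence staying
    and moving up. *)
Lemma chain_mean_rev n g : chain_mean n (fun k => g (n - k)%N) = chain_mean n g.
Proof.
elim: n g => //= n IHn g; rewrite -[RHS]IHn; apply: eq_chain_mean => k kn.
rewrite /chain_step subSS subSn // natrB //; congr (_ / _); ring.
Qed.

(** Each step carries the factor [4 (n + 1)]: 2 from the Eulerian recursion times the denominator
    [2 (n + 1)] of [chain_step]. *)
Lemma weighted_sum_chain n g :
  weighted_sum n g 1 = (4 ^ n * n`!)%:R * chain_mean n g.
Proof.
elim: n g => [|n IHn] g; first by rewrite weighted_sum0 /= mul1r.
rewrite weighted_sum_eulerian /= -/(chain_mean n) IHn.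
have -> : 2 * ((4 ^ n * n`!)%:R * chain_mean n (fun k => (2 * k%:R + 1) * g k
             + (2 * n%:R + 1 - 2 * k%:R) * g k.+1))
  = (4 ^ n * n`!)%:R * (4 * n.+1%:R) * chain_mean n (chain_step n g).
  rewrite mulrCA -mulrA; congr (_ * _); rewrite -!chain_meanZ.
  apply: eq_chain_mean => k _; rewrite /chain_step.
  have : n.+1%:R != 0 :> R by rewrite pnatr_eq0.
  by rewrite -!natr1 => n0; field.
by congr (_ * _); rewrite -!natrM expnS factS; congr _%:R; lia.
Qed.

Lemma sum_tableau n g :
  \sum_(t : tableau n) g (diag_count (val t)) = (4 ^ n * n`!)%:R * chain_mean n g.
Proof.
rewrite -weighted_sum_chain /weighted_sum.
under [RHS]eq_bigr do rewrite expr1n mulr1.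
rewrite [RHS](reindex_omap (val : tableau n -> filling n) insub) /=; last first.
  by move=> f fP; rewrite insubT.
by apply: eq_bigl => t; rewrite valK eqxx andbT (valP t).
Qed.

Lemma card_tableau n : #|{: tableau n}| = (4 ^ n * n`!)%N.
Proof.
apply/eqP; rewrite -(eqr_nat R); apply/eqP.
have := @sum_tableau n (fun=> 1); rewrite chain_mean_cst mulr1 => <-.
by rewrite -sum1_card natr_sum.
Qed.

Lemma tableau_average n g :
  (\sum_(t : tableau n) g (diag_count (val t))) / #|{: tableau n}|%:R
  = chain_mean n g.
Proof.
by rewrite sum_tableau card_tableau mulrAC divff ?mul1r // pnatr_eq0 -lt0n
  muln_gt0 expn_gt0 fact_gt0.
Qed.

End chain.

Local Open Scope classical_set_scope.

(** * Taylor estimates *)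

Section taylor.
Variable R : realType.
Implicit Types (f : R -> R) (lo hi C : R).

Lemma derive_bounded_increment f f1 lo hi C :
  (forall x, lo <= x <= hi -> is_derive x 1 f (f1 x)) ->
  (forall x, lo <= x <= hi -> `|f1 x| <= C) ->
  forall x y, lo <= x <= hi -> lo <= y <= hi -> `|f y - f x| <= C * (hi - lo).
Proof.
move=> df bf x y; wlog xy : x y / x <= y => [hw|] xI yI.
  have [|/ltW] := leP x y; first by move=> ?; exact: hw.
  by move=> ?; rewrite distrC; exact: hw.
have sub z : x <= z <= y -> lo <= z <= hi by move: xI yI; lra.
have [||c cxy ->] := @MVT_segment _ f f1 _ _ xy.
- by move=> z; rewrite in_itv/= => zxy; apply/df/sub; lra.
- apply: derivable_within_continuous => z; rewrite in_itv/= => zxy.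
  by apply: ex_derive; exact/df/sub.
rewrite normrM ler_pM ?normr_ge0 ?bf ?sub // ger0_norm; move: xI yI xy; lra.
Qed.

(** The increment bound is applied to [f] minus the linear term at [a], whose derivative is in turn
    an increment of [f1]. [taylor3] repeats this one order higher; sharp factorial constants are not
    sought. *)
Lemma taylor2 f f1 f2 lo hi C :
  (forall x, lo <= x <= hi -> is_derive x 1 f (f1 x)) ->
  (forall x, lo <= x <= hi -> is_derive x 1 f1 (f2 x)) ->
  (forall x, lo <= x <= hi -> `|f2 x| <= C) ->
  forall a b, lo <= a <= hi -> lo <= b <= hi ->
  `|f b - f a - (b - a) * f1 a| <= C * (hi - lo) ^+ 2.
Proof.
move=> df df1 bf a b aI bI.
have dg x : lo <= x <= hi ->
    is_derive x 1 (fun y => f y - f1 a * y) (f1 x - f1 a).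
  move=> xI; have dfx := df x xI; apply: is_derive_eq.
  by rewrite -[_%:A]/(_ * _) mulr1.
have bg x : lo <= x <= hi -> `|f1 x - f1 a| <= C * (hi - lo).
  by move=> xI; exact: (derive_bounded_increment df1 bf).
have := derive_bounded_increment dg bg aI bI.
by congr (`|_| <= _); ring.
Qed.

Lemma taylor3 f f1 f2 f3 lo hi C :
  (forall x, lo <= x <= hi -> is_derive x 1 f (f1 x)) ->
  (forall x, lo <= x <= hi -> is_derive x 1 f1 (f2 x)) ->
  (forall x, lo <= x <= hi -> is_derive x 1 f2 (f3 x)) ->
  (forall x, lo <= x <= hi -> `|f3 x| <= C) ->
  forall a b, lo <= a <= hi -> lo <= b <= hi ->
  `|f b - f a - (b - a) * f1 a - (b - a) ^+ 2 / 2 * f2 a| <= C * (hi - lo) ^+ 3.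
Proof.
move=> df df1 df2 bf a b aI bI.
have dg x : lo <= x <= hi ->
    is_derive x 1 (fun y => f y - f1 a * y - (f2 a / 2) * (y - a) ^+ 2)
      (f1 x - f1 a - (x - a) * f2 a).
  move=> xI; have dfx := df x xI; apply: is_derive_eq.
  by rewrite /GRing.scale /=; field.
have bg x : lo <= x <= hi -> `|f1 x - f1 a - (x - a) * f2 a| <= C * (hi - lo) ^+ 2.
  by move=> xI; exact: (taylor2 df1 df2 bf).
have := derive_bounded_increment dg bg aI bI.
by congr (`|_| <= _); field.
Qed.

End taylor.

(** * The normal distribution function and the heat equation *)

Section normal.
Variable R : realType.

Definition Phi (x : R) : R := fine (normal_prob (0 : R) 1 `]-oo, x]).
Definition phi : R -> R := normal_pdf 0 1.

Lemma phiE x : phi x = normal_peak 1 * expR (- x ^+ 2 / 2).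
Proof. by rewrite /phi normal_pdfE ?oner_eq0 // /normal_fun subr0 expr1n. Qed.

Lemma is_derive_Phi (x : R) : is_derive x 1 Phi (phi x).
Proof.
have [||||d1 d2] := @continuous_FTC1 R phi -oo%O x (x + 1).
- by rewrite ltrDl.
- apply: (integrableS _ _ (subsetT _)) => //; exact: integrable_normal_pdf.
- by rewrite ltNyr.
- by apply: continuous_normal_pdf; rewrite oner_eq0.
by apply: DeriveDef; [exact: d1 | rewrite -derive1E d2].
Qed.

Lemma Phi_le x y : x <= y -> Phi x <= Phi y.
Proof.
move=> xy; rewrite /Phi fine_le ?fin_num_measure //.
by apply: le_measure; rewrite ?inE //; apply: subset_itvl; rewrite bnd_simp.
Qed.

Lemma Phi_ge0 x : 0 <= Phi x.
Proof. exact: fine_ge0. Qed.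

Lemma Phi_le1 x : Phi x <= 1.
Proof.
rewrite -lee_fin fineK ?fin_num_measure //; exact: probability_le1.
Qed.

(** The identity as a standard normal variable: its cdf is [Phi], so the limits of cdfs at infinity
    apply. *)
Let idR : measurableTypeR R -> R := idfun.

#[local] HB.instance Definition _ :=
  @isMeasurableFun.Build _ _ _ _ idR (@measurable_id _ _ setT).

Lemma Phi_tails (e : R) : 0 < e ->
  exists2 K : R, 0 < K & forall x, K <= x -> Phi (- x) <= e /\ 1 - e <= Phi x.
Proof.
move=> e0.
pose X : {RV (normal_prob (0 : R) 1) >-> R} := idR.
have /fine_cvg/cvgrPdist_le/(_ e e0)[M1 [_ h1]] := cvg_cdfNy0 X.
have /fine_cvg/cvgrPdist_le/(_ e e0)[M2 [_ h2]] := cvg_cdfy1 X.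
exists (1 + `|M1| + `|M2|) => [|x xK]; first by rewrite -addrA ltr_pwDl // addr_ge0.
have M1n := ler_norm (- M1); have M2n := ler_norm M2.
have := normr_ge0 M1; have := normr_ge0 M2; rewrite normrN in M1n => n1 n2.
split.
  have := h1 (- x); rewrite sub0r normrN => h.
  apply: (le_trans (ler_norm _)); apply: h; lra.
have := h2 x => h; rewrite lerBlDr -lerBlDl.
apply: (le_trans (ler_norm _)); apply: h; lra.
Qed.

(* [hermite2], [hermite3] and [hermite4] are, up to sign, the derivatives of [phi]. *)
Definition hermite2 (y : R) : R := y * phi y.
Definition hermite3 (y : R) : R := (y ^+ 2 - 1) * phi y.
Definition hermite4 (y : R) : R := (3 * y - y ^+ 3) * phi y.

Lemma is_derive_phi (x : R) : is_derive x 1 phi (- hermite2 x).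
Proof.
have -> : phi = fun y => normal_peak 1 * expR (- y ^+ 2 / 2) by apply/funext/phiE.
by apply: is_derive_eq; rewrite /hermite2 phiE /GRing.scale /=; field.
Qed.

Lemma is_derive_hermite2 (x : R) : is_derive x 1 hermite2 (- hermite3 x).
Proof.
have dphi := is_derive_phi x; apply: is_derive_eq.
rewrite /hermite3 /hermite2 /GRing.scale /=; ring.
Qed.

Lemma hermite_bounded : exists2 M : R, 0 < M & forall y,
  [/\ phi y <= M, `|hermite2 y| <= M, `|hermite3 y| <= M & `|hermite4 y| <= M].
Proof.
have p0 : 0 < normal_peak (1 : R) by rewrite normal_peak_gt0 ?oner_eq0.
(* With [N] the peak, [phi <= N] and [y ^ 4 phi <= 16 N], so a factor bounded by [7 (1 + y ^ 4)]
   gives at most [7 * 17 N = 119 N]. All the polynomial factors here are so bounded. *)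
exists (200 * normal_peak (1 : R)) => [|y]; first by rewrite mulr_gt0.
have pe : 0 < phi y by rewrite phiE mulr_gt0 ?expR_gt0.
have xe (x : R) : 0 <= x -> x * expR (- x) <= 1.
  move=> x0; rewrite expRN ler_pdivrMr ?expR_gt0 // mul1r.
  by apply: le_trans (expR_ge1Dx x); rewrite lerDr.
have p1 : phi y <= normal_peak 1 by apply: normal_pdf_ub; rewrite oner_eq0.
have p4 : y ^+ 4 * phi y <= 16 * normal_peak 1.
  have := xe (y ^+ 2 / 4); rewrite divr_ge0 ?sqr_ge0 // => /(_ isT) h.
  rewrite phiE.
  have -> : - y ^+ 2 / 2 = - (y ^+ 2 / 4) - (y ^+ 2 / 4) by field.
  rewrite expRD; set E := expR _.
  have -> : y ^+ 4 * (normal_peak 1 * (E * E)) =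
      (16 * normal_peak 1) * (y ^+ 2 / 4 * E) ^+ 2 by field.
  rewrite ler_piMr ?mulr_ge0 ?(ltW p0) // expr_le1 //.
  by rewrite mulr_ge0 ?expR_ge0 // divr_ge0 ?sqr_ge0.
have b (a : R) : `|a| <= 7 * (1 + y ^+ 4) ->
    `|a * phi y| <= 200 * normal_peak (1 : R).
  move=> ha; rewrite normrM (gtr0_norm pe).
  apply: (le_trans (ler_wpM2r (ltW pe) ha)); move: p1 p4.
  by move: (phi y) (y ^+ 4) (normal_peak 1) p0 pe => P Y N *; lra.
have y20 := sqr_ge0 y.
have y4 : y ^+ 4 = y ^+ 2 * y ^+ 2 by ring.
have y3 : y ^+ 3 = y * y ^+ 2 by ring.
have y1l : y <= 1 + y ^+ 2 by nra.
have y1r : - (1 + y ^+ 2) <= y by nra.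
split; [lra | apply: b | apply: b | apply: b]; rewrite ler_norml y4; nra.
Qed.

Definition heat (w T : R) : R := Phi (w * (Num.sqrt T)^-1).

Lemma is_derive_isqrt (T : R) : 0 < T ->
  is_derive T 1 (fun x => (Num.sqrt x)^-1) (- (Num.sqrt T)^-1 ^+ 3 / 2).
Proof.
move=> T0; have sT : Num.sqrt T != 0 by rewrite gt_eqF // sqrtr_gt0.
have d := is_derive1_sqrt T0.
by apply: (is_derive_eq (is_deriveV sT d)); rewrite /GRing.scale /=; field.
Qed.

(** The value is half the second derivative of [heat] in [w]: the heat equation. *)
Lemma is_derive_heat w (T : R) : 0 < T ->
  is_derive T 1 (heat w)
    (- (Num.sqrt T)^-1 ^+ 2 / 2 * hermite2 (w * (Num.sqrt T)^-1)).
Proof.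
move=> T0; have d := is_derive_isqrt T0.
have dP := is_derive_Phi (w * (Num.sqrt T)^-1).
have dw : is_derive T 1 (fun x => w * (Num.sqrt x)^-1)
    (w * (- (Num.sqrt T)^-1 ^+ 3 / 2)).
  by apply: is_derive_eq; rewrite /GRing.scale.
have -> : heat w = Phi \o (fun x => w * (Num.sqrt x)^-1) by [].
apply: (is_derive_eq (@is_derive1_comp _ _ (fun x => w * (Num.sqrt x)^-1) _ _ _ dP dw)).
rewrite /hermite2; ring.
Qed.

Lemma is_derive_heat2 w (T : R) : 0 < T ->
  is_derive T 1
    (fun x => - (Num.sqrt x)^-1 ^+ 2 / 2 * hermite2 (w * (Num.sqrt x)^-1))
    ((Num.sqrt T)^-1 ^+ 4 / 4 * hermite4 (w * (Num.sqrt T)^-1)).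
Proof.
move=> T0; have d := is_derive_isqrt T0.
have sT : Num.sqrt T != 0 by rewrite gt_eqF // sqrtr_gt0.
have dh := is_derive_hermite2 (w * (Num.sqrt T)^-1).
have dw : is_derive T 1 (fun x => w * (Num.sqrt x)^-1)
    (w * (- (Num.sqrt T)^-1 ^+ 3 / 2)).
  by apply: is_derive_eq; rewrite /GRing.scale.
have dc := @is_derive1_comp _ _ (fun x => w * (Num.sqrt x)^-1) _ _ _ dh dw.
have dq : is_derive T 1 (fun x => (Num.sqrt x)^-1 ^+ 2)
   (- (Num.sqrt T)^-1 ^+ 4).
  by apply: is_derive_eq; rewrite /GRing.scale /=; field.
pose f := fun x => (Num.sqrt x)^-1 ^+ 2 : R.
pose g := hermite2 \o (fun x => w * (Num.sqrt x)^-1).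
have -> : (fun x => - (Num.sqrt x)^-1 ^+ 2 / 2 * hermite2 (w * (Num.sqrt x)^-1))
   = (fun x => (- 2^-1) * (f x * g x)).
  by apply/funext => x; rewrite /f /g /=; ring.
have df : is_derive T 1 f _ := dq.
have dg : is_derive T 1 g _ := dc.
apply: is_derive_eq.
by rewrite /f /g /GRing.scale /= /hermite4 /hermite3 /hermite2; field.
Qed.

End normal.

(** * The central limit theorem for the chain *)

Section clt.
Variable R : realType.

Lemma chain_mean_dist n (f g e : nat -> R) :
  (forall k, (k <= n)%N -> `|f k - g k| <= e k) ->
  `|chain_mean n f - chain_mean n g| <= chain_mean n e.
Proof.
move=> fg; rewrite ler_norml; apply/andP; split.
  rewrite lerNl opprB lerBlDl -chain_meanD chain_mean_le // => k /fg.
  by rewrite ler_norml; lra.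
by rewrite lerBlDl -chain_meanD chain_mean_le // => k /fg; rewrite ler_norml; lra.
Qed.

Section bounded_hermite.
Variable M : R.
Hypothesis hermiteM : forall y : R,
  [/\ phi y <= M, `|hermite2 y| <= M, `|hermite3 y| <= M & `|hermite4 y| <= M].

(** Third-order Taylor expansion of [Phi] from [w q] to [(w + h) q]; [lo] and [hi] cover both signs
    of [h]. *)
Lemma heat_space (w h T : R) (q := (Num.sqrt T)^-1) :
  `|heat (w + h) T - heat w T - h * q * phi (w * q)
     + h ^+ 2 / 2 * (q ^+ 2 * hermite2 (w * q))| <= M * (q * `|h|) ^+ 3.
Proof.
pose lo := Num.min (w * q) ((w + h) * q).
pose hi := Num.max (w * q) ((w + h) * q).
have d1 x : lo <= x <= hi -> is_derive x 1 (@Phi R) (phi x).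
  by move=> _; exact: is_derive_Phi.
have d2 x : lo <= x <= hi -> is_derive x 1 (@phi R) (- hermite2 x).
  by move=> _; exact: is_derive_phi.
have d3 x : lo <= x <= hi -> is_derive x 1 (fun y : R => - hermite2 y) (hermite3 x).
  move=> _; have d := is_derive_hermite2 x.
  by apply: is_derive_eq; rewrite opprK.
have b x : lo <= x <= hi -> `|hermite3 x| <= M by case: (hermiteM x).
have := taylor3 d1 d2 d3 b (a := w * q) (b := (w + h) * q).
rewrite !le_max !ge_min !lexx !orbT /= => /(_ isT isT).
have -> : hi - lo = q * `|h|.
  have q0 : 0 <= q by rewrite invr_ge0 sqrtr_ge0.
  have -> : q * `|h| = `|h * q| by rewrite normrM (ger0_norm q0) mulrC.
  rewrite /hi /lo mulrDl; have [hq|hq] := leP 0 (h * q).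
    by rewrite max_r ?min_l ?lerDl // ger0_norm //; ring.
  by rewrite max_l ?min_r ?gerDl ?(ltW hq) // ltr0_norm //; ring.
by congr (`|_| <= _); rewrite /heat -/q; field.
Qed.

(** The first-order term has the same factor [q ^ 2 hermite2] as the second-order term of
    [heat_space], so a time increment can offset a variance. The second derivative is bounded by
    means of [q], as [1 / sqrt x] is largest at the left end [T]. *)
Lemma heat_time (w T s : R) (q := (Num.sqrt T)^-1) : 0 < T -> 0 <= s ->
  `|heat w (T + s) - heat w T + s / 2 * (q ^+ 2 * hermite2 (w * q))|
    <= M * q ^+ 4 * s ^+ 2.
Proof.
move=> T0 s0.
have q0 : 0 < q by rewrite invr_gt0 sqrtr_gt0.
have d1 x : T <= x <= T + s -> is_derive x 1 (heat w)
    (- (Num.sqrt x)^-1 ^+ 2 / 2 * hermite2 (w * (Num.sqrt x)^-1)).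
  by move=> /andP[Tx _]; apply: is_derive_heat; exact: lt_le_trans Tx.
have d2 x : T <= x <= T + s -> is_derive x 1
    (fun x => - (Num.sqrt x)^-1 ^+ 2 / 2 * hermite2 (w * (Num.sqrt x)^-1))
    ((Num.sqrt x)^-1 ^+ 4 / 4 * hermite4 (w * (Num.sqrt x)^-1)).
  by move=> /andP[Tx _]; apply: is_derive_heat2; exact: lt_le_trans Tx.
have b x : T <= x <= T + s ->
    `|(Num.sqrt x)^-1 ^+ 4 / 4 * hermite4 (w * (Num.sqrt x)^-1)| <= M * q ^+ 4.
  move=> /andP[Tx _]; have x0 := lt_le_trans T0 Tx.
  have sx0 : 0 < (Num.sqrt x)^-1 by rewrite invr_gt0 sqrtr_gt0.
  have sq : (Num.sqrt x)^-1 <= q.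
    by rewrite /q lef_pV2 ?posrE ?sqrtr_gt0 // ler_wsqrtr.
  rewrite normrM mulrC; apply: ler_pM => //; first by case: (hermiteM (w * (Num.sqrt x)^-1)).
  have s4 : 0 <= (Num.sqrt x)^-1 ^+ 4 by rewrite exprn_ge0 // ltW.
  rewrite ger0_norm ?divr_ge0 //.
  have : (Num.sqrt x)^-1 ^+ 4 <= q ^+ 4 by rewrite lerXn2r ?nnegrE ?(ltW sx0) ?(ltW q0).
  by move: s4; lra.
have := taylor2 d1 d2 b (a := T) (b := T + s).
rewrite !lexx lerDl s0 /= => /(_ isT isT).
have -> : T + s - T = s by ring.
by congr (`|_| <= _); rewrite -/q; field.
Qed.

(** For a two-point increment of mean zero the first-order terms cancel. The second-order terms
    combine with the time increment into the difference between the variance and [s]; the rest is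
    bounded by the Taylor remainders. *)
Lemma heat_step (w T s p p' h h' r Q : R) :
  0 < T -> 0 <= s -> 0 <= p -> 0 <= p' -> p + p' = 1 -> p * h + p' * h' = 0 ->
  `|h| <= r -> `|h'| <= r -> (Num.sqrt T)^-1 <= Q ->
  `|p * heat (w + h) T + p' * heat (w + h') T - heat w (T + s)| <=
  `|p * h ^+ 2 + p' * h' ^+ 2 - s| / 2 * (M * Q ^+ 2) + M * (Q * r) ^+ 3
  + M * Q ^+ 4 * s ^+ 2.
Proof.
move=> T0 s0 p0 p'0 pp ph hr h'r qQ.
have := heat_space w h T; have := heat_space w h' T; have := heat_time w T0 s0.
have M0 : 0 <= M.
  by case: (hermiteM 0) => _ + _ _; apply: le_trans; exact: normr_ge0.
set q := (Num.sqrt T)^-1 in qQ *; rewrite /=.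
have q0 : 0 < q by rewrite invr_gt0 sqrtr_gt0.
have [_ h2 _ _] := hermiteM (w * q).
set ph0 := phi _; set H := hermite2 _ in h2 *.
set Us := heat w (T + s); set U := heat w T; set Uh := heat (w + h) T.
set Uh' := heat (w + h') T.
set A := (X in `|X| <= _); move=> hA; set B := (X in `|X| <= _); move=> hB.
set C := (X in `|X| <= _); move=> hC.
have -> : p * Uh + p' * Uh' - Us = p * C + p' * B - A
    - (p * h ^+ 2 + p' * h' ^+ 2 - s) / 2 * (q ^+ 2 * H).
  (* The two added terms vanish by [pp] and [ph]; with them the decomposition is a plain field
     identity. *)
  rewrite [RHS](_ : _ = p * Uh + p' * Uh' - Us + (1 - (p + p')) * U
    - (p * h + p' * h') * (q * ph0)); last by rewrite /A /B /C; field.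
  by rewrite pp ph; ring.
have bC : `|C| <= M * (Q * r) ^+ 3.
  apply: (le_trans hC); rewrite ler_wpM2l // lerXn2r ?nnegrE ?mulr_ge0 ?(ltW q0) //.
  - exact: (le_trans (ltW q0)).
  - exact: (le_trans (normr_ge0 h)).
  - by rewrite ler_pM // ltW.
have bB : `|B| <= M * (Q * r) ^+ 3.
  apply: (le_trans hB); rewrite ler_wpM2l // lerXn2r ?nnegrE ?mulr_ge0 ?(ltW q0) //.
  - exact: (le_trans (ltW q0)).
  - exact: (le_trans (normr_ge0 h)).
  - by rewrite ler_pM // ltW.
have bA : `|A| <= M * Q ^+ 4 * s ^+ 2.
  apply: (le_trans hA); rewrite ler_wpM2r ?sqr_ge0 // ler_wpM2l //.
  by rewrite lerXn2r ?nnegrE ?(ltW q0) // (le_trans (ltW q0)).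
have bH : `|q ^+ 2 * H| <= M * Q ^+ 2.
  rewrite normrM mulrC ler_pM // ger0_norm ?sqr_ge0 //.
  by rewrite lerXn2r ?nnegrE ?(ltW q0) // (le_trans (ltW q0)).
apply: (le_trans (ler_normB _ _)); rewrite [leLHS]addrC -[leRHS]addrA; apply: lerD.
  rewrite normrM ler_pM // normrM normfV (ger0_norm (ler0n _ 2)) //.
apply: (le_trans (ler_normB _ _)); apply: lerD => //.
apply: (le_trans (ler_normD _ _)); rewrite !normrM (ger0_norm p0) (ger0_norm p'0).
have -> : M * (Q * r) ^+ 3 = p * (M * (Q * r) ^+ 3) + p' * (M * (Q * r) ^+ 3).
  by rewrite -mulrDl pp mul1r.
by apply: lerD; apply: ler_wpM2l.
Qed.

Section telescope.
Variables (n : nat) (a e : R).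
Hypotheses (n0 : (0 < n)%N) (e0 : 0 < e).

Let sd : R := Num.sqrt (n%:R / 12).
Let Q := (Num.sqrt e)^-1.

(* [k (A_k - k / 2)] is a martingale; the time left at step [k] is chosen so that the
   decrements match its conditional variances [k ^ 2 / 4] up to lower order terms. *)
Let time k : R := e + 1 - (k%:R / n%:R) ^+ 3.
Let smoothed k (j : nat) : R :=
  heat (a - k%:R * (j%:R - k%:R / 2) / (n%:R * sd)) (time k).

Let nR0 : 0 < n%:R :> R. Proof. by rewrite ltr0n. Qed.
Let sd0 : 0 < sd. Proof. by rewrite sqrtr_gt0 divr_gt0. Qed.
Let sd2 : sd ^+ 2 = n%:R / 12. Proof. by rewrite sqr_sqrtr // divr_ge0. Qed.
Let M0 : 0 <= M.
Proof. by case: (hermiteM 0) => _ + _ _; apply: le_trans; exact: normr_ge0. Qed.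
Let Q0 : 0 < Q. Proof. by rewrite invr_gt0 sqrtr_gt0. Qed.

(** The squared deviation is kept apart because only its mean, not its maximum, is small enough; the
    other terms are uniform in [j]. *)
Let step_error k (j : nat) : R :=
  M * Q ^+ 2 * (6 / n%:R ^+ 3) * (j%:R - k%:R / 2) ^+ 2
  + (M * Q ^+ 2 * (3 / 2) / n%:R ^+ 2 + M * (Q * sd^-1) ^+ 3
     + M * Q ^+ 4 * (9 / n%:R ^+ 2)).

Let smoothed_step k j : (j <= k)%N -> (k < n)%N ->
  `|chain_step k (smoothed k.+1) j - smoothed k j| <= step_error k j.
Proof.
move=> jk kn.
have jk' : j%:R <= k%:R :> R by rewrite ler_nat.
have j0 : 0 <= j%:R :> R by [].
have kn' : k%:R + 1 <= n%:R :> R by rewrite natr1 ler_nat.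
have k0 : 0 < k%:R + 1 :> R by rewrite natr1.
pose D : R := j%:R - k%:R / 2.
pose p : R := (2 * j%:R + 1) / (2 * (k%:R + 1)).
pose p' : R := (2 * k%:R + 1 - 2 * j%:R) / (2 * (k%:R + 1)).
(* Staying takes the martingale from [k D] to [(k + 1) (D - 1 / 2)], moving up takes it to
   [(k + 1) (D + 1 / 2)]; [h] and [h'] are these increments with sign reversed and rescaled. *)
pose h : R := ((k%:R + 1) / 2 - D) / (n%:R * sd).
pose h' : R := (- ((k%:R + 1) / 2) - D) / (n%:R * sd).
pose s := time k - time k.+1.
have c0 : 0 < n%:R * sd by rewrite mulr_gt0.
have sE : s = (3 * k%:R ^+ 2 + 3 * k%:R + 1) / n%:R ^+ 3.
  by rewrite /s /time -natr1; field; rewrite gt_eqF.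
have c2 : (n%:R * sd) ^+ 2 = n%:R ^+ 3 / 12 by rewrite exprMn sd2; field.
have -> : chain_step k (smoothed k.+1) j =
   p * heat (a - k%:R * D / (n%:R * sd) + h) (time k.+1)
   + p' * heat (a - k%:R * D / (n%:R * sd) + h') (time k.+1).
  rewrite /chain_step /smoothed.
  have -> : a - k.+1%:R * (j%:R - k.+1%:R / 2) / (n%:R * sd) =
     a - k%:R * D / (n%:R * sd) + h.
    by rewrite /h /D -natr1; field; rewrite !gt_eqF.
  have -> : a - k.+1%:R * (j.+1%:R - k.+1%:R / 2) / (n%:R * sd) =
     a - k%:R * D / (n%:R * sd) + h'.
    by rewrite /h' /D -!natr1; field; rewrite !gt_eqF.
  by rewrite /p /p' -[k.+1%:R]natr1; field; rewrite gt_eqF.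
have -> : smoothed k j = heat (a - k%:R * D / (n%:R * sd)) (time k.+1 + s).
  by rewrite /smoothed /s -/D [time k.+1 + _]addrC subrK.
have eT : e <= time k.+1.
  rewrite /time -addrA lerDl subr_ge0 expr_le1 ?divr_ge0 //.
  by rewrite ler_pdivrMr // mul1r ler_nat.
have s0 : 0 <= s.
  by rewrite sE divr_ge0 ?exprn_ge0 // ?(ltW nR0) //; nra.
have hb x : `|x| <= k%:R + 1 -> `|x / (n%:R * sd)| <= sd^-1.
  move=> xk; rewrite normrM normfV (gtr0_norm c0) ler_pdivrMr // mulrCA.
  by rewrite mulVf ?gt_eqF // mulr1 (le_trans xk).
have pp : p + p' = 1 by rewrite /p /p'; field; rewrite gt_eqF.
have ph : p * h + p' * h' = 0.
  by rewrite /p /p' /h /h' /D; field; rewrite !gt_eqF.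
(* The conditional variance is [((k + 1) ^ 2 / 4 - D ^ 2) / (n ^ 3 / 12)]; its leading part
   [3 k ^ 2 / n ^ 3] cancels against [s]. *)
have v : p * h ^+ 2 + p' * h' ^+ 2 - s = (3 * k%:R + 2 - 12 * D ^+ 2) / n%:R ^+ 3.
  rewrite /h /h' !expr_div_n c2 sE /p /p' /D; field.
  by rewrite !gt_eqF.
have qQ : (Num.sqrt (time k.+1))^-1 <= Q.
  by rewrite /Q lef_pV2 ?posrE ?sqrtr_gt0 ?(lt_le_trans e0) // ler_wsqrtr.
have p0 : 0 <= p by rewrite divr_ge0 //; lra.
have p'0 : 0 <= p' by rewrite divr_ge0 //; lra.
have hr : `|h| <= sd^-1 by apply: hb; rewrite /D ler_norml; lra.
have h'r : `|h'| <= sd^-1 by apply: hb; rewrite /D ler_norml; lra.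
apply: (le_trans (heat_step _ (lt_le_trans e0 eT) s0 p0 p'0 pp ph hr h'r qQ)).
rewrite v /step_error -/D.
have n3 : 0 < n%:R ^+ 3 :> R by rewrite exprn_gt0.
have b1 : `|(3 * k%:R + 2 - 12 * D ^+ 2) / n%:R ^+ 3| / 2 <=
    6 / n%:R ^+ 3 * D ^+ 2 + 3 / 2 / n%:R ^+ 2.
  rewrite normrM normfV (gtr0_norm n3).
  have -> : 6 / n%:R ^+ 3 * D ^+ 2 + 3 / 2 / n%:R ^+ 2 =
     (12 * D ^+ 2 + 3 * n%:R) / n%:R ^+ 3 / 2 by field; rewrite gt_eqF.
  rewrite ler_pM2r ?invr_gt0 // ler_pM2r ?invr_gt0 //.
  by have := sqr_ge0 D; rewrite ler_norml; move: (D ^+ 2) => X; lra.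
have b2 : s ^+ 2 <= 9 / n%:R ^+ 2.
  have -> : 9 / n%:R ^+ 2 = (3 / n%:R) ^+ 2 :> R by field; rewrite gt_eqF.
  rewrite lerXn2r ?nnegrE ?divr_ge0 // sE.
  have -> : 3 / n%:R = 3 * n%:R ^+ 2 / n%:R ^+ 3 :> R by field; rewrite gt_eqF.
  by rewrite ler_pM2r ?invr_gt0 //; nra.
have MQ2 : 0 <= M * Q ^+ 2 by rewrite mulr_ge0 ?exprn_ge0 // ltW.
have MQ4 : 0 <= M * Q ^+ 4 by rewrite mulr_ge0 ?exprn_ge0 // ltW.
rewrite [leRHS]addrA; apply: lerD; last by rewrite ler_wpM2l.
rewrite [leRHS]addrA; apply: lerD => //; apply: (le_trans (ler_wpM2r MQ2 b1)).
by rewrite le_eqVlt; apply/orP; left; apply/eqP; ring.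
Qed.

Lemma smoothed_cdf_error :
  `|chain_mean n (fun j => heat (a - (j%:R - n%:R / 2) / sd) e) - heat a (1 + e)|
  <= M * (Q ^+ 2 + 12 * Q ^+ 3 + Q ^+ 4) * (sd^-1 + sd^-1 ^+ 2).
Proof.
(* The mean of [step_error]: since the mean squared deviation is at most [n / 4], its term adds a
   second [3 / 2] to the one already present. *)
pose E : R := M * Q ^+ 2 * 3 / n%:R ^+ 2 + M * (Q * sd^-1) ^+ 3
     + M * Q ^+ 4 * (9 / n%:R ^+ 2).
have telescope k : (k <= n)%N ->
    `|chain_mean k (smoothed k) - smoothed 0%N 0%N| <= k%:R * E.
  elim: k => [_|k IHk kn]; first by rewrite subrr normr0 mul0r.
  have -> : chain_mean k.+1 (smoothed k.+1) - smoothed 0%N 0%N =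
    (chain_mean k (chain_step k (smoothed k.+1)) - chain_mean k (smoothed k)) +
    (chain_mean k (smoothed k) - smoothed 0%N 0%N) by rewrite /=; ring.
  apply: (le_trans (ler_normD _ _)).
  rewrite -natr1 mulrDl mul1r addrC lerD ?IHk 1?ltnW //.
  apply: (le_trans (chain_mean_dist (fun j jk => smoothed_step jk kn))).
  rewrite /step_error chain_meanD chain_mean_cst chain_meanZ.
  have c0 : 0 <= M * Q ^+ 2 * (6 / n%:R ^+ 3).
    by rewrite !mulr_ge0 ?invr_ge0 ?exprn_ge0 // ?ltW.
  have kn' : k%:R / 4 <= n%:R / 4 :> R by rewrite ler_pM2r ?invr_gt0 // ler_nat ltnW.
  have := ler_wpM2l c0 (le_trans (chain_mean_sqr_le R k) kn').
  have -> : M * Q ^+ 2 * (6 / n%:R ^+ 3) * (n%:R / 4) =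
      M * Q ^+ 2 * (3 / 2) / n%:R ^+ 2 by field; rewrite gt_eqF.
  rewrite /E; have -> : M * Q ^+ 2 * 3 / n%:R ^+ 2 =
    M * Q ^+ 2 * (3 / 2) / n%:R ^+ 2 + M * Q ^+ 2 * (3 / 2) / n%:R ^+ 2 by field; rewrite gt_eqF.
  move=> hX; apply: (le_trans (lerD hX (lexx _))).
  by rewrite le_eqVlt; apply/orP; left; apply/eqP; ring.
have := telescope n (leqnn n).
have -> : chain_mean n (smoothed n) = chain_mean n (fun j => heat (a - (j%:R - n%:R / 2) / sd) e).
  have -> : smoothed n = fun j => heat (a - (j%:R - n%:R / 2) / sd) e; last by [].
  apply/funext => j; rewrite /smoothed.
  have -> : time n = e by rewrite /time divff ?gt_eqF // expr1n addrK.
  have -> // : n%:R * (j%:R - n%:R / 2) / (n%:R * sd) = (j%:R - n%:R / 2) / sd.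
  by field; rewrite !gt_eqF.
have -> : smoothed 0%N 0%N = heat a (1 + e).
  rewrite /smoothed !mul0r subr0.
  by have -> : time 0 = 1 + e by rewrite /time mul0r expr0n subr0 addrC.
move/le_trans; apply.
(* This turns the total [n E] of the [n] steps into powers of [1 / sd]. *)
have nE : n%:R = 12 * sd ^+ 2 :> R by rewrite sd2; field.
have -> : n%:R * E = M * (Q ^+ 2 / 4 * sd^-1 ^+ 2 + 12 * Q ^+ 3 * sd^-1
    + 3 / 4 * Q ^+ 4 * sd^-1 ^+ 2).
  by rewrite /E nE; field; rewrite gt_eqF.
rewrite -[leRHS]mulrA ler_wpM2l //.
have r0 : 0 < sd^-1 by rewrite invr_gt0.
have := mulr_ge0 (exprn_ge0 2 (ltW Q0)) (exprn_ge0 2 (ltW r0)).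
have := mulr_ge0 (exprn_ge0 4 (ltW Q0)) (exprn_ge0 2 (ltW r0)).
have := mulr_ge0 (exprn_ge0 3 (ltW Q0)) (exprn_ge0 2 (ltW r0)).
have := mulr_ge0 (exprn_ge0 2 (ltW Q0)) (ltW r0).
have := mulr_ge0 (exprn_ge0 4 (ltW Q0)) (ltW r0).
move: (Q ^+ 2) (Q ^+ 3) (Q ^+ 4) (sd^-1) (sd^-1 ^+ 2) => A B C X Y.
lra.
Qed.

End telescope.

End bounded_hermite.

(** * Passage to the limit and removal of the smoothing *)

Lemma cvg_isqrt_nat : (Num.sqrt (n%:R / 12 : R))^-1 @[n --> \oo] --> (0 : R).
Proof.
apply/cvgrPdist_le => d d0; near=> n.
rewrite sub0r normrN ger0_norm ?invr_ge0 ?sqrtr_ge0 //.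
have nd : 12 / d ^+ 2 <= n%:R by near: n; exact: nbhs_infty_ger.
have n0 : 0 < n%:R :> R by apply: lt_le_trans nd; rewrite divr_gt0 ?exprn_gt0.
rewrite -[d]invrK lef_pV2 ?posrE ?invr_gt0 ?sqrtr_gt0 ?divr_gt0 //.
rewrite -(ger0_norm (ltW (_ : 0 < d^-1))) ?invr_gt0 // -sqrtr_sqr ler_wsqrtr //.
by rewrite ler_pdivlMr // exprVn mulrC.
Unshelve. all: by end_near. Qed.

Lemma smoothed_cdf_cvg (a e : R) : 0 < e ->
  chain_mean n (fun j => heat (a - (j%:R - n%:R / 2) / Num.sqrt (n%:R / 12)) e)
    @[n --> \oo] --> heat a (1 + e).
Proof.
move=> e0; have [M M0 hM] := hermite_bounded R.
pose Q := (Num.sqrt e)^-1; pose K := M * (Q ^+ 2 + 12 * Q ^+ 3 + Q ^+ 4).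
have cvgB : K * ((Num.sqrt (n%:R / 12))^-1 + (Num.sqrt (n%:R / 12))^-1 ^+ 2)
    @[n --> \oo] --> (0 : R).
  have -> : 0 = K * (0 + 0 * 0) :> R by rewrite mul0r addr0 mulr0.
  apply: cvgM; first exact: cvg_cst.
  apply: cvgD; first exact: cvg_isqrt_nat.
  by apply: cvgM; exact: cvg_isqrt_nat.
apply/cvgrPdist_le => d d0; near=> n.
have n0 : (0 < n)%N by near: n; exact: nbhs_infty_gt.
rewrite distrC (le_trans (smoothed_cdf_error hM a n0 e0)) // -/Q -/K.
apply: (le_trans (ler_norm _)); rewrite -normrN -[- _]add0r.
by near: n; move/cvgrPdist_le : cvgB; exact.
Unshelve. all: by end_near. Qed.

(** The indicator of [y <= x] lies, up to [d / 4], between the smoothed indicators centered at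
    [x - t] and [x + t]. Convergence of the smoothed means and the closeness of their limits to
    [Phi x] cost [d / 4] each. *)
Lemma chain_cdf_cvg (x : R) :
  chain_mean n (fun j => ((j%:R - n%:R / 2) / Num.sqrt (n%:R / 12) <= x)%R%:R)
    @[n --> \oo] --> Phi x.
Proof.
apply/cvgrPdist_le => d d0.
have [M M0 hM] := hermite_bounded R.
have lip (u v : R) : `|Phi u - Phi v| <= M * `|u - v|.
  wlog vu : u v / v <= u => [hw|].
    have [|/ltW] := leP v u; first exact: hw.
    by rewrite distrC [`|u - v|]distrC; exact: hw.
  rewrite [`|u - v|]ger0_norm ?subr_ge0 //.
  apply: (@derive_bounded_increment _ (@Phi R) (@phi R) v u M); rewrite ?lexx ?vu // => y _.
    exact: is_derive_Phi.
  rewrite ger0_norm; first by case: (hM y).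
  by rewrite phiE mulr_ge0 ?expR_ge0 ?normal_peak_ge0.
have d4 : 0 < d / 4 by rewrite divr_gt0.
have [K K0 tails] := Phi_tails d4.
(* [t <= 1 / L] makes the Lipschitz error [M (|x| + 2) t] at most [d / 4], and [t <= 1 / K] reaches
   the tails of [Phi]. *)
pose L := 4 * M * (`|x| + 2) / d.
have L0 : 0 < L by rewrite divr_gt0 // !mulr_gt0 // ltr_wpDl.
pose t := (1 + K + L)^-1.
have t0 : 0 < t by rewrite invr_gt0; lra.
have t1 : t <= 1 by rewrite invf_le1; lra.
have tK : K <= t^-1 by rewrite invrK; lra.
have tL : M * ((`|x| + 2) * t) <= d / 4.
  have Lt : L * t <= 1.
    by rewrite ler_pdivrMr ?mul1r; lra.
  have -> : M * ((`|x| + 2) * t) = (d / 4) * (L * t).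
    by rewrite /L; field; rewrite gt_eqF.
  by rewrite ler_piMr // ltW.
(* Then [sqrt e = t ^ 2]: the smoothing width is small against the shift [t], and
   [t / sqrt e = 1 / t >= K]. *)
pose e := t ^+ 4.
have e0 : 0 < e by rewrite exprn_gt0.
have et : e <= t by rewrite /e exprS ler_piMr ?(ltW t0) // exprn_ile1 // ltW.
have sqe : (Num.sqrt e)^-1 = t^-1 ^+ 2.
  have -> : e = (t ^+ 2) ^+ 2 by rewrite /e -exprM.
  by rewrite sqrtr_sqr ger0_norm ?sqr_ge0 // exprVn.
have tt : t * (Num.sqrt e)^-1 = t^-1 by rewrite sqe; field; rewrite gt_eqF.
have heat_lim u : `|u - x| <= t -> `|heat u (1 + e) - Phi x| <= d / 4.
  move=> ux; rewrite /heat; set s := Num.sqrt (1 + e).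
  have s2 : s ^+ 2 = 1 + e by rewrite sqr_sqrtr //; lra.
  have s1 : 1 <= s.
    by rewrite -[1]sqrtr1 ler_wsqrtr // lerDl ltW.
  have sV : 1 - s^-1 <= e.
    have -> : e = s ^+ 2 - 1 by rewrite s2; ring.
    have s0 : 0 < s by lra.
    rewrite -subr_ge0; have -> : s ^+ 2 - 1 - (1 - s^-1) = (s - 1) * (s ^+ 2 + s - 1) / s.
      by field; rewrite gt_eqF.
    by rewrite divr_ge0 ?(ltW s0) // mulr_ge0; nra.
  have sV1 : s^-1 <= 1 by rewrite invf_le1; lra.
  apply: (le_trans (lip _ _)); apply: le_trans tL; rewrite ler_wpM2l ?(ltW M0) //.
  (* The two parts are at most [t] and [(|x| + 1) t], which accounts for the [|x| + 2] in [L]. *)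
  have -> : u * s^-1 - x = (u - x) - u * (1 - s^-1) by ring.
  apply: (le_trans (ler_normB _ _)); rewrite normrM.
  have u1 : `|u| <= `|x| + 1.
    have -> : u = x + (u - x) by ring.
    by apply: (le_trans (ler_normD _ _)); rewrite lerD2l (le_trans ux).
  have sn : `|1 - s^-1| <= t by rewrite ger0_norm; lra.
  have := ler_pM (normr_ge0 _) (normr_ge0 _) u1 sn.
  lra.
near=> n.
have up : `|heat (x + t) (1 + e) - chain_mean n (fun j =>
    heat (x + t - (j%:R - n%:R / 2) / Num.sqrt (n%:R / 12)) e)| <= d / 4.
  by near: n; move/cvgrPdist_le : (@smoothed_cdf_cvg (x + t) e e0); exact.
have dn : `|heat (x - t) (1 + e) - chain_mean n (fun j =>
    heat (x - t - (j%:R - n%:R / 2) / Num.sqrt (n%:R / 12)) e)| <= d / 4.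
  by near: n; move/cvgrPdist_le : (@smoothed_cdf_cvg (x - t) e e0); exact.
have hu : `|heat (x + t) (1 + e) - Phi x| <= d / 4.
  by apply: heat_lim; rewrite addrC addKr ger0_norm // ltW.
have hd : `|heat (x - t) (1 + e) - Phi x| <= d / 4.
  by apply: heat_lim; rewrite addrC addKr normrN ger0_norm // ltW.
have [tlo thi] := tails _ tK.
have q0 : 0 <= (Num.sqrt e)^-1 by rewrite invr_ge0.
have le_up : chain_mean n (fun j => ((j%:R - n%:R / 2) / Num.sqrt (n%:R / 12) <= x)%R%:R)
    <= chain_mean n (fun j =>
    heat (x + t - (j%:R - n%:R / 2) / Num.sqrt (n%:R / 12)) e) + d / 4.
  rewrite -[d / 4](chain_mean_cst n) -chain_meanD chain_mean_le // => j _.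
  set y := _ / Num.sqrt _; have [yx|_] := leP y x; last first.
    by rewrite addr_ge0 ?Phi_ge0 // ltW.
  rewrite -lerBlDr (le_trans thi) // Phi_le // -tt ler_wpM2r //; lra.
have le_dn : chain_mean n (fun j =>
    heat (x - t - (j%:R - n%:R / 2) / Num.sqrt (n%:R / 12)) e) <=
    chain_mean n (fun j => ((j%:R - n%:R / 2) / Num.sqrt (n%:R / 12) <= x)%R%:R) + d / 4.
  rewrite -[d / 4](chain_mean_cst n) -chain_meanD chain_mean_le // => j _.
  set y := _ / Num.sqrt _; have [_|xy] := leP y x.
    by rewrite (le_trans (Phi_le1 _)) // lerDl ltW.
  rewrite add0r (le_trans _ tlo) // Phi_le // -tt -[- (t * _)]mulNr ler_wpM2r //; lra.
move: up dn hu hd; rewrite !ler_norml; lra.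
Unshelve. all: by end_near. Qed.

End clt.

(** * Distribution of the diagonal counts *)

Lemma card_on_diagonal n : #|[pred b : box n | on_diagonal b]| = n.
Proof.
have diag_lt (i : 'I_n) : (i + rev_ord i < n)%N by rewrite /=; have := ltn_ord i; lia.
pose diag i := mk_box (diag_lt i).
have diag_inj : injective diag by move=> i j /(congr1 val) [].
rewrite -[RHS]card_ord -(card_codom diag_inj); apply: eq_card => b.
rewrite inE; apply/idP/codomP => [|[i ->]].
  case: b => -[i j] ij; rewrite /on_diagonal /row_of /col_of /= => /eqP ijn.
  exists i; apply/val_inj => /=; congr pair; apply/ord_inj => /=; lia.
by rewrite /on_diagonal /row_of /col_of /=; have := ltn_ord i; lia.
Qed.

(** Each of the [n] diagonal boxes is filled, so it is counted either here or in [diag_count]; the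
    truncated subtraction is therefore exact. *)
Lemma diag_beta_deltaE (R : realType) n (t : tableau n) :
  diag_beta_delta R t = (n - diag_count (val t))%:R.
Proof.
congr _%:R.
have /forallP diagN : [forall b, on_diagonal b ==> (val t b != None)].
  by have /and3P[] := valP t.
have := card_on_diagonal n.
rewrite -(cardID [pred b | is_alpha_gamma (val t b)]) => cN.
apply: (@addnI (diag_count (val t))); rewrite subnKC; last first.
  by rewrite -[leqRHS]cN leq_addr.
apply: etrans cN; congr addn; apply: eq_card => b; rewrite !inE; have := diagN b.
by case: on_diagonal => //=; case: (val t b) => [[]|].
Qed.

Section uniform.
Variables (R : realType) (n : nat).
Local Open Scope ereal_scope.

(** By [tableau_probE] the measure is a scaled sum of Dirac masses; nonnegativity lets the integral
    pass through the scaling and the sum. *)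
Lemma expectation_tableau (X : tableau n -> R) : (forall t, 0 <= X t)%R ->
  'E_(tableau_prob R n)[X] = ((\sum_t X t) / #|{: tableau n}|%:R)%:E.
Proof.
move=> X0; rewrite unlock.
rewrite (eq_measure_integral (mscale ((#|{: tableau n}|%:R : R)^-1%:nng)%R
    (msum (fun i => \d_(nth point (enum {: tableau n}) i)) #|{: tableau n}|)));
  last by move=> E _ _; exact: tableau_probE.
rewrite ge0_integral_mscale //=; last by move=> t _; rewrite lee_fin.
rewrite ge0_integral_measure_sum //=; last by move=> t _; rewrite lee_fin.
under eq_bigr do rewrite integral_dirac //= diracT mul1e.
rewrite sumEFin -EFinM mulrC; congr (_ / _)%:E.
by rewrite -[RHS]big_enum /= (big_nth point) big_mkord cardE.
Qed.

Lemma expectation_diag (g : nat -> R) : (forall k, 0 <= g k)%R ->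
  'E_(tableau_prob R n)[fun t => g (diag_count (val t))] = (chain_mean n g)%:E.
Proof. by move=> g0; rewrite expectation_tableau // tableau_average. Qed.

Lemma tableau_prob_diag (g : nat -> bool) :
  tableau_prob R n [set t | g (diag_count (val t))] =
  (chain_mean n (fun k => (g k)%:R))%:E.
Proof.
rewrite -tableau_average /tableau_prob; congr (_ / _)%:E.
rewrite -sum1_card natr_sum big_mkcond /=; apply: eq_bigr => t _.
rewrite !inE; case: ifPn => [/set_mem -> //|].
by move/negP => h; case: (boolP (g _)) => // gt; case: h; rewrite mem_set.
Qed.

End uniform.

Local Open Scope ereal_scope.

Theorem theorem9 (R : realType) :
  let P := tableau_prob R in
  let A n : {RV (P n) >-> R} := @diag_alpha_gamma R n in
  let B n : {RV (P n) >-> R} := @diag_beta_delta R n in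
  let A' n : {RV (P n) >-> R} := standardized (A n) in
  let B' n : {RV (P n) >-> R} := standardized (B n) in
  let N01 : probability (measurableTypeR R) R := normal_prob (0 : R)%R 1%R in
  (forall n : nat, (1 <= n)%N -> 'E_(P n)[A n] = (n%:R / 2)%:E) /\
  (forall n : nat, (2 <= n)%N -> 'V_(P n)[A n] = ((n%:R + 1) / 12)%:E) /\
  cvg_distribution A' N01 /\
  (forall n : nat, (1 <= n)%N -> eq_distribution (B n) (A n)) /\
  (forall n : nat, (1 <= n)%N -> 'E_(P n)[B n] = (n%:R / 2)%:E) /\
  (forall n : nat, (2 <= n)%N -> 'V_(P n)[B n] = ((n%:R + 1) / 12)%:E) /\
  cvg_distribution B' N01.
Proof.
move=> P A B A' B' N01.
have meanE n : chain_mean n (fun k => k%:R : R) = (n%:R / 2)%R.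
  have := chain_mean_center R n; rewrite chain_meanD chain_mean_cst => /eqP.
  by rewrite addr_eq0 opprK => /eqP.
have BE n : (B n : tableau n -> R) = fun t => (n - diag_count (val t))%:R.
  by apply/funext => t; exact: diag_beta_deltaE.
have EA n : 'E_(P n)[A n] = (n%:R / 2)%:E.
  by rewrite (@expectation_diag R n (fun k => k%:R)) // meanE.
have EB n : 'E_(P n)[B n] = (n%:R / 2)%:E.
  rewrite BE (@expectation_diag R n (fun k => (n - k)%:R)) //.
  by rewrite (chain_mean_rev n (fun k => k%:R)) meanE.
have VA n : (2 <= n)%N -> 'V_(P n)[A n] = ((n%:R + 1) / 12)%:E.
  move=> n2; rewrite /variance covariance.unlock EA /=.
  rewrite (@expectation_diag R n (fun k => ((k%:R - n%:R / 2) * (k%:R - n%:R / 2))%R)).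
    by rewrite -(chain_mean_sqr R n2).
  by move=> k; exact: sqr_ge0.
have VB n : (2 <= n)%N -> 'V_(P n)[B n] = ((n%:R + 1) / 12)%:E.
  move=> n2; rewrite /variance covariance.unlock EB /= BE.
  rewrite (@expectation_diag R n
    (fun k => (((n - k)%:R - n%:R / 2) * ((n - k)%:R - n%:R / 2))%R)).
    rewrite (chain_mean_rev n (fun k => ((k%:R - n%:R / 2) * (k%:R - n%:R / 2))%R)).
    by rewrite -(chain_mean_sqr R n2).
  by move=> k; exact: sqr_ge0.
have distA n (E : set R) : distribution (P n) (A n) E =
    (chain_mean n (fun k => `[< E k%:R >]%:R))%:E.
  rewrite -tableau_prob_diag; congr tableau_prob.
  by apply/seteqP; split=> t /asboolP.
(* [B_n = n - A_n] reflects the event, and [chain_mean_rev] undoes the reflection. *)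
have distB n (E : set R) : distribution (P n) (B n) E = distribution (P n) (A n) E.
  rewrite distA -chain_mean_rev -(@tableau_prob_diag R n (fun k => `[< E (n - k)%:R >])).
  rewrite /distribution /pushforward BE; congr tableau_prob.
  by apply/seteqP; split=> t /asboolP.
have cvgA : cvg_distribution A' N01.
  move=> x _; have -> : N01 `]-oo, x] = (Phi x)%:E.
    by rewrite fineK ?fin_num_measure.
  have -> : (fun n => cdf (A' n) x) = EFin \o (fun n =>
    chain_mean n (fun j => ((j%:R - n%:R / 2) / Num.sqrt (n%:R / 12) <= x)%R%:R)).
    by apply/funext => n; rewrite /= -tableau_prob_diag.
  by apply: cvg_EFin; [exact: nearW | exact: chain_cdf_cvg].
split; first by move=> n _.
split=> //; split=> //; split; first by move=> n _ E _; exact: distB.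
split; first by move=> n _.
split=> // x xc; have := cvgA x xc.
suff -> : (fun n => cdf (B' n) x) = (fun n => cdf (A' n) x) by [].
apply/funext => n.
(* The cdf of a standardized count at [x] is the law of the count itself on [S], so [distB] carries
   the limit over. *)
pose S := (fun y : R => (y - n%:R / 2) / Num.sqrt (n%:R / 12))%R @^-1` `]-oo, x].
exact: (distB n S).
Qed.
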